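(* Let $s\ge4$. A symmetric matrix $A\in\mathbb{C}^{s\times s}$ has an eigenspace of codimension $\le1$ if and only if its $2\times2$-minors satisfy the following for all $i,j,k,\ell\in\{1,\ldots,s\}$ distinct: $$A_{ij|k\ell}=0,\qquad A_{ik|i\ell}=A_{jk|j\ell}\qquad\text{and}\qquad A_{ik|ik}-A_{i\ell|i\ell}=A_{jk|jk}-A_{j\ell|j\ell}.$$ These equations describe (as their common zero set) the Zariski closure, in the complex vector space $\mathrm{Sym}^2\mathbb{C}^s$ of complex symmetric $s\times s$-matrices, of the set of real symmetric $s\times s$-matrices with an eigenvalue of multiplicity $\ge s-1$.
   Context: For a matrix $A=(a_{ij})\in\mathbb{C}^{s\times s}$, $A_{ij|k\ell}:=a_{ik}a_{j\ell}-a_{i\ell}a_{jk}$ denotes the $2\times2$-minor of $A$ with rows $i,j$ and columns $k,\ell$. An eigenspace of codimension $\le 1$ means that for some $\lambda\in\mathbb{C}$ the space $\ker(A-\lambda\,\mathrm{id})\subset\mathbb{C}^s$ has dimension $\ge s-1$. *)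

(* Defs.v *)
From mathcomp Require Import all_boot all_order all_algebra.
From mathcomp Require Import classical_sets reals.
From mathcomp Require Import complex mpoly.

Set Implicit Arguments.
Unset Strict Implicit.
Unset Printing Implicit Defensive.

Import GRing.Theory.

Local Open Scope classical_set_scope.
Local Open Scope ring_scope.
Local Open Scope complex_scope.

(* Zariski topology of a finite-dimensional vector space V: polynomial
   functions on V are polynomials in the coordinates of V in a basis. A linear
   change of basis is an automorphism of the polynomial ring, so the topology
   does not depend on the choice of [vbasis]. *)
Definition polyfun (K : fieldType) (V : vectType K)
    (p : {mpoly K[\dim {:V}]}) (v : V) : K :=
  p.@[fun i => coord (vbasis {:V}) i v].

Definition zariski_closed (K : fieldType) (V : vectType K) (Z : set V) : Prop :=
  exists I : set {mpoly K[\dim {:V}]},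
    Z = [set v | forall p, I p -> polyfun p v = 0].

Definition zariski_closure (K : fieldType) (V : vectType K) (S : set V) :
    set V :=
  \bigcap_(Z in [set Z : set V | zariski_closed Z /\ S `<=` Z]) Z.

(* Sym^2 K^s as a subspace of the s x s matrices. *)
Definition symv (K : fieldType) (s : nat) : {vspace 'M[K]_s} :=
  fixedSpace (linfun (@trmx K s s)).

Lemma mem_symv (K : fieldType) (s : nat) (A : 'M[K]_s) :
  A \in symv K s <-> A^T = A.
Proof.
by split=> [/fixedSpaceP|AT]; last apply/fixedSpaceP; rewrite lfunE.
Qed.

(* A_{ij|kl}: rows i, j and columns k, l. *)
Definition minor2 (K : fieldType) (s : nat) (A : 'M[K]_s) (i j k l : 'I_s) : K :=
  A i k * A j l - A i l * A j k.

Definition minor_equations (K : fieldType) (s : nat) (A : 'M[K]_s) : Prop :=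
  forall i j k l : 'I_s, uniq [:: i; j; k; l] ->
    [/\ minor2 A i j k l = 0,
        minor2 A i k i l = minor2 A j k j l
      & minor2 A i k i k - minor2 A i l i l
        = minor2 A j k j k - minor2 A j l j l].

(* [eigenspace A a] is the space of row vectors u with u *m A = a *: u; for
   symmetric A, transposition identifies it with the kernel of A - a on column
   vectors, and in general the two have the same dimension. *)
Definition has_eigenspace_codim_le1 (K : fieldType) (s : nat) (A : 'M[K]_s) :
    Prop :=
  exists a : K, (s - 1 <= \rank (eigenspace A a))%N.

Definition has_eigenvalue_mult_ge (K : fieldType) (s m : nat) (A : 'M[K]_s) :
    Prop :=
  exists a : K, eigenvalue A a /\ (m <= mup a (char_poly A))%N.

Definition real_sym_mult_ge (R : realType) (s m : nat) :
    set (subvs_of (symv R[i] s)) :=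
  [set B | exists A : 'M[R]_s,
     [/\ A^T = A, has_eigenvalue_mult_ge m A
       & vsval B = map_mx (real_complex R) A]].
Arguments real_sym_mult_ge : clear implicits.

(* Main.v *)
Require Import Defs.
From mathcomp Require Import all_boot all_order all_algebra.
From mathcomp Require Import classical_sets reals.
From mathcomp Require Import complex mpoly.
From mathcomp Require Import ring zify.

(* Over any field, both directions of the first claim are manipulations of
   minors of B := A - a: the equations are invariant under A |-> A - a, and hold
   trivially when B has rank at most 1. Conversely, if A k l <> 0 with k <> l,
   the value a := A i i - A i k * A i l / A k l does not depend on i outside
   {k, l}, and for this a every minor of B through the entry (k, l) vanishes.

   For the closure: algebraic and geometric multiplicities agree for real
   symmetric matrices, so these matrices satisfy the equations. Conversely, a
   complex solution is B = a + u^T u. Splitting a and u into real and imaginary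
   parts puts B at t = 'i on the curve
     t |-> (Re a + t Im a) + (Re u + t Im u)^T (Re u + t Im u),
   which is polynomial in t and real symmetric with an eigenvalue of
   multiplicity >= s - 1 for real t; a polynomial vanishing at infinitely many
   points of this curve vanishes on all of it. *)

Set Implicit Arguments.
Unset Strict Implicit.
Unset Printing Implicit Defensive.

Import GRing.Theory Num.Theory.

Local Open Scope classical_set_scope.
Local Open Scope ring_scope.
Local Open Scope complex_scope.

(** * Rank at most one: minors and eigenspaces *)

Lemma mxrank_le1P (K : fieldType) (m n : nat) (N : 'M[K]_(m, n)) :
  (\rank N <= 1)%N <-> forall i j k l, N i j * N k l = N i l * N k j.
Proof.
split=> [r1 i j k l|minors].
  have [c [r ->]] : exists (c : 'cV[K]_m) (r : 'rV[K]_n), N = c *m r.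
    (* In the rank factorization of [N] the inner dimension is [\rank N]; inner dimension 0 is
       replaced by zero vectors. *)
    move: (mulmx_base N); move: (col_base N) (row_base N).
    case: (\rank N) r1 => [|[]//] _ c r <-; last by exists c, r.
    by exists 0, 0; rewrite mul0mx thinmx0 mul0mx.
  by rewrite !mxE !big_ord1; ring.
have [->|/matrix0Pn[k [l Nkl]]] := eqVneq N 0; first by rewrite mxrank0.
have -> : N = col l N *m ((N k l)^-1 *: row k N).
  apply/matrixP=> i j; rewrite !mxE big_ord1 !mxE.
  by apply: (mulfI Nkl); rewrite mulrC minors; field.
exact: leq_trans (mxrankM_maxr _ _) (rank_leq_row _).
Qed.

Lemma has_eigenspace_codim_le1P (K : fieldType) (s : nat) (A : 'M[K]_s) :
  (0 < s)%N ->
  has_eigenspace_codim_le1 A <-> exists a, (\rank (A - a%:M)%R <= 1)%N.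
Proof.
move=> s_gt0; suff rkE a :
    (s - 1 <= \rank (eigenspace A a))%N = (\rank (A - a%:M)%R <= 1)%N.
  by split=> -[a]; exists a; rewrite ?rkE // -rkE.
rewrite mxrank_ker; have := rank_leq_row (A - a%:M); lia.
Qed.

Lemma exists_notin_ord (s : nat) (t : seq 'I_s) :
  (size t < s)%N -> exists i, i \notin t.
Proof.
move=> ts; suff : (0 < #|[predC t]|)%N by case/card_gt0P=> i; exists i.
rewrite -(ltn_add2l #|t|) addn0 cardC card_ord.
exact: leq_ltn_trans (card_size t) ts.
Qed.

(** * The minor equations over an arbitrary field *)

Lemma minor_equations_subM (K : fieldType) (s : nat) (A : 'M[K]_s) (a : K) :
  minor_equations (A - a%:M) <-> minor_equations A.
Proof.
suff imp (B : 'M[K]_s) (b : K) :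
    minor_equations B -> minor_equations (B - b%:M).
  by split=> [/(imp _ (- a))|/imp//]; rewrite raddfN opprK subrK.
move=> eqB i j k l ijkl; have [e1 e2 e3] := eqB i j k l ijkl.
have offd x y : x != y -> (B - b%:M) x y = B x y.
  by move=> /negPf xy; rewrite !mxE xy subr0.
have diag x : (B - b%:M) x x = B x x - b by rewrite !mxE eqxx.
move: ijkl e1 e2 e3; rewrite /minor2 /= !inE !negb_or !andbT -!andbA.
move=> /and5P[ij ik il jk /andP[jl kl]] e1 e2 e3.
rewrite !diag !offd // 1?eq_sym //; split=> //.
  (* The shift subtracts b B_kl from the second kind of minor and b (B_kk - B_ll) from the third
     difference. Neither depends on [i], so both sides change equally. *)
  transitivity (B i i * B k l - B i l * B k i - b * B k l); first ring.
  by rewrite e2; ring.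
transitivity (B i i * B k k - B i k * B k i - (B i i * B l l - B i l * B l i)
  - b * (B k k - B l l)); first ring.
by rewrite e3; ring.
Qed.

Lemma minor_equations_rank_le1 (K : fieldType) (s : nat) (A : 'M[K]_s) :
  (\rank A <= 1)%N -> minor_equations A.
Proof.
move=> /mxrank_le1P e.
have minor0 i j k l : minor2 A i j k l = 0 by rewrite /minor2 e subrr.
by move=> i j k l _; split; rewrite !minor0.
Qed.

Lemma uniq4 (T : eqType) (i j k l : T) :
  i != j -> i != k -> i != l -> j != k -> j != l -> k != l ->
  uniq [:: i; j; k; l].
Proof. by rewrite /= !inE !negb_or => -> -> -> -> -> ->. Qed.

(** It suffices that all minors through the nonzero entry (k, l) vanish, which is [key] below. The
    second family of equations carries the vanishing from [i0] to every index outside {k, l}; the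
    third gives the principal minor on {k, l}. *)
Lemma offdiag_minor_equations_rank_le1 (K : fieldType) (s : nat) (B : 'M[K]_s)
    (k l i0 : 'I_s) :
  (4 <= s)%N -> B^T = B -> minor_equations B -> uniq [:: i0; k; l] ->
  B k l != 0 -> B i0 i0 * B k l = B i0 k * B i0 l ->
  (\rank B <= 1)%N.
Proof.
move=> s4 /matrixP BT eqB + Bkl Bi0.
rewrite /= !inE !negb_or !andbT => /andP[/andP[i0k i0l] kl].
have sB x y : B x y = B y x by rewrite -[LHS]BT mxE.
have minor0 i j p q : i != j -> i != p -> i != q -> j != p -> j != q ->
    p != q -> B i p * B j q = B i q * B j p.
  by move=> *; have [|/subr0_eq] := eqB i j p q; first exact: uniq4.
have diag i : i != k -> i != l -> B i i * B k l = B i k * B i l.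
  move=> ik il; have [->//|ii0] := eqVneq i i0.
  have [|_ + _] := eqB i i0 k l; first exact: uniq4.
  rewrite /minor2 Bi0 (sB k i) (sB k i0) (mulrC (B i0 l)) subrr => /subr0_eq ->.
  exact: mulrC.
(* A fourth index [i] trades the minor pq|pj for iq|ij, whose product with [B p q] is zero by [dpq]
   and [minor0]. General [p] and [q] serve both (k, l) and (l, k). *)
have row_pq p q j : p != q -> B p q != 0 ->
    (forall i, i != p -> i != q -> B i i * B p q = B i p * B i q) ->
    j != p -> j != q -> B p j * B p q = B p p * B q j.
  move=> pq Bpq dpq jp jq.
  have [ i ] : exists i, i \notin [:: p; q; j] by exact: exists_notin_ord.
  rewrite !inE !negb_or => /and3P[ip iq ij].
  have [|_ e _] := eqB p i q j; first by apply: uniq4 => //; rewrite eq_sym.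
  have eij : B i j * B p q = B i p * B q j.
    by rewrite (sB p q) minor0 // eq_sym.
  move: e; rewrite /minor2 (sB q p) (sB q i) => e.
  apply/esym/subr0_eq/(mulIf Bpq); rewrite mul0r.
  rewrite [B p p * _ - _]e.
  by rewrite mulrBl (mulrAC (B i i)) dpq // (mulrAC (B i j)) eij; ring.
have row_k j : j != k -> j != l -> B k j * B k l = B k k * B l j.
  by move=> jk jl; exact: row_pq.
have row_l j : j != k -> j != l -> B l j * B k l = B l l * B k j.
  move=> jk jl; rewrite (sB k l).
  apply: row_pq; rewrite // 1?sB 1?(eq_sym l) //.
  by move=> i il ik; rewrite diag // mulrC.
(* The third equation for k, i, l, j expresses this minor through the principal minors on {k, j},
   {i, l} and {i, j}. Each vanishes after multiplication by [B k l], or by its square for {i, j}. *)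
have diag_kl : B k k * B l l = B k l * B k l.
  have [ i ] : exists i, i \notin [:: k; l].
    by apply/exists_notin_ord/ltnW.
  rewrite !inE !negb_or => /andP[ik il].
  have [j] : exists j, j \notin [:: k; l; i] by apply: exists_notin_ord.
  rewrite !inE !negb_or => /and3P[jk jl ji].
  have [|_ _] := eqB k i l j; first by apply: uniq4 => //; rewrite eq_sym.
  rewrite /minor2 (sB l k) (sB j k) (sB l i) (sB j i).
  have -> : B k k * B j j - B k j * B k j = 0.
    apply: (mulIf Bkl); rewrite mul0r mulrBl -mulrA diag // -(mulrA (B k j)).
    by rewrite row_k // (sB j k) (sB j l); ring.
  have -> : B i i * B l l - B i l * B i l = 0.
    apply: (mulIf Bkl); rewrite mul0r mulrBl mulrAC diag // -(mulrA (B i l)).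
    by rewrite {3}(sB i l) row_l // (sB i k); ring.
  have -> : B i i * B j j - B i j * B i j = 0.
    apply: (mulIf Bkl); apply: (mulIf Bkl).
    transitivity ((B i i * B k l) * (B j j * B k l)
      - (B i j * B k l) * (B i j * B l k)); first by rewrite (sB l k); ring.
    rewrite !diag // (minor0 i k j l) ?(minor0 i l j k) // 1?eq_sym //.
    by rewrite (sB j k) (sB j l); ring.
  by rewrite !subr0 => /subr0_eq.
apply/mxrank_le1P.
have key i j : B i j * B k l = B i l * B k j.
  have [->|ik] := eqVneq i k; first exact: mulrC.
  have [->//|jl] := eqVneq j l.
  have [-> {i ik}|il] := eqVneq i l; have [-> {j jl}|jk] := eqVneq j k.
  - by rewrite (sB l k) -diag_kl mulrC.
  - exact: row_l.
  - by rewrite sB row_k // (sB l i) mulrC.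
  have [<-|ij] := eqVneq i j; first by rewrite diag // (sB k i) mulrC.
  by rewrite minor0 // eq_sym.
(* With one factor [B k l] for each entry, [key] turns both sides into the same product. *)
move=> i j p q; apply: (mulIf Bkl); apply: (mulIf Bkl).
transitivity ((B i j * B k l) * (B p q * B k l)); first ring.
transitivity ((B i q * B k l) * (B p j * B k l)); last ring.
by rewrite !key; ring.
Qed.

(** For diagonal [A] the third equation factors as (A_ii - A_jj)(A_kk - A_ll) = 0. So two different
    diagonal entries force all the others to agree, and one of the two must agree with them as
    well. *)
Lemma diag_minor_equations_rank_le1 (K : fieldType) (s : nat) (A : 'M[K]_s) :
  (4 <= s)%N -> (forall k l, k != l -> A k l = 0) -> minor_equations A ->
  exists a, (\rank (A - a%:M)%R <= 1)%N.
Proof.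
move=> s4 A0 eqA.
have eq_or i j k l : uniq [:: i; j; k; l] -> A i i = A j j \/ A k k = A l l.
  move=> ijkl; have [_ _] := eqA i j k l ijkl.
  move: ijkl; rewrite /minor2 /= !inE !negb_or !andbT -!andbA.
  move=> /and5P[ij ik il jk /andP[jl kl]].
  rewrite !(A0 i k, A0 i l, A0 j k, A0 j l) //.
  rewrite !mul0r !subr0 -!mulrBr => /eqP.
  rewrite -subr_eq0 -mulrBl mulf_eq0 !subr_eq0 => /orP[]/eqP; tauto.
have [c [p Ac]] : exists c p, forall x, x != p -> A x x = c.
  have [/existsP[i /existsP[j Aij]]|Aconst] :=
    boolP [exists i, exists j, A i i != A j j]; last first.
    have [ p _ ] : exists p : 'I_s, p \notin [::].
      by apply/exists_notin_ord/leq_trans/s4.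
    exists (A p p), p => x _; apply/eqP; apply: contraNT Aconst => Axp.
    by apply/existsP; exists x; apply/existsP; exists p.
  have ij : i != j by apply: contraNneq Aij => ->.
  have [ k ] : exists k, k \notin [:: i; j].
    by apply/exists_notin_ord/leq_trans/s4.
  rewrite !inE !negb_or => /andP[ki kj].
  have Ak x : x != i -> x != j -> A x x = A k k.
    move=> xi xj; have [->//|xk] := eqVneq x k.
    case: (eq_or i j x k) => //; first by apply: uniq4; rewrite // eq_sym.
    by move/eqP; rewrite (negPf Aij).
  exists (A k k); have [Aik|Aik] := eqVneq (A i i) (A k k).
    exists j => x xj; have [->//|xi] := eqVneq x i; exact: Ak.
  exists i => x xi; have [->|xj] := eqVneq x j; last exact: Ak.
  have [ m ] : exists m, m \notin [:: i; j; k] by exact: exists_notin_ord.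
  rewrite !inE !negb_or => /and3P[mi mj mk]; rewrite -(Ak m) //.
  case: (eq_or i k j m) => //; first by apply: uniq4; rewrite // eq_sym.
  by move/eqP; rewrite (negPf Aik).
exists c; have -> : A - c%:M = (A p p - c) *: delta_mx p p.
  apply/matrixP=> x y; rewrite !mxE.
  have [->|xy] := eqVneq x y; last first.
    rewrite (A0 x y) // subr0; suff /negPf-> : ~~ ((x == p) && (y == p)).
      by rewrite mulr0.
    by apply: contra xy => /andP[/eqP-> /eqP->].
  by have [->|/Ac->] := eqVneq y p; rewrite /= ?mulr1 // mulr0 subrr.
by rewrite (leq_trans (mxrankS (scalemx_sub _ (submx_refl _)))) // mxrank_delta.
Qed.

Lemma symmetric_minor_equationsP (K : fieldType) (s : nat) (A : 'M[K]_s) :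
  (4 <= s)%N -> A^T = A ->
  minor_equations A <-> exists a, (\rank (A - a%:M)%R <= 1)%N.
Proof.
move=> s4 AT; split=> [eqA|[a rA]]; last first.
  exact/(minor_equations_subM A a)/minor_equations_rank_le1.
have [/existsP[k /existsP[l /andP[kl Akl]]]|Adiag] :=
  boolP [exists k, exists l, (k != l) && (A k l != 0)]; last first.
  apply: diag_minor_equations_rank_le1 => // k l kl.
  apply/eqP; apply: contraNT Adiag => Akl.
  by apply/existsP; exists k; apply/existsP; exists l; rewrite kl.
have [ i ] : exists i, i \notin [:: k; l].
  by apply/exists_notin_ord/leq_trans/s4.
rewrite !inE negb_or => /andP[ik il].
(* This [a] solves (A_ii - a) A_kl = A_ik A_il, making the minor ik|il of A - a vanish. *)
pose a := A i i - A i k * A i l / A k l; exists a.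
have offd x y : x != y -> (A - a%:M) x y = A x y.
  by move=> /negPf xy; rewrite !mxE xy subr0.
apply: (@offdiag_minor_equations_rank_le1 _ _ _ k l i) => //.
- by rewrite linearB /= AT tr_scalar_mx.
- exact/minor_equations_subM.
- by rewrite /= !inE negb_or ik il kl.
- by rewrite offd.
by rewrite (offd k l) // (offd i k) // (offd i l) // !mxE eqxx /a mulr1n; field.
Qed.

(** * Algebraic and geometric multiplicity *)

Lemma mxrank_diag (K : fieldType) (n : nat) (d : 'rV[K]_n) :
  \rank (diag_mx d) = #|[pred i | d 0 i != 0]|.
Proof.
have /eqmx_rank -> : (diag_mx d ==
    \sum_(i | d 0%R i != 0%R) <<delta_mx 0 i : 'rV[K]_n>>)%MS.
  apply/andP; split.
    apply/row_subP=> i; rewrite row_diag_mx.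
    have [->|di] := eqVneq (d 0 i) 0; first by rewrite scale0r sub0mx.
    by apply: scalemx_sub; apply: (sumsmx_sup i); rewrite // genmxE.
  apply/sumsmx_subP=> i di; rewrite genmxE -[delta_mx 0 i](scalerK di).
  by rewrite -row_diag_mx scalemx_sub // row_sub.
have /mxdirectP/= -> :=
  @mxdirect_delta K _ (fun i => d 0 i != 0) n id (in2W (@inj_id _)).
rewrite -sum1_card; apply: eq_bigr => i _.
by rewrite genmxE mxrank_delta.
Qed.

Lemma char_poly_sim (K : fieldType) (n : nat) (P A D : 'M[K]_n) :
  P \in unitmx -> P *m A = D *m P -> char_poly A = char_poly D.
Proof.
move=> Pu PA; pose P' := map_mx polyC P.
have detP' : \det P' != 0.
  by rewrite det_map_mx polyC_eq0 -unitfE -unitmxE.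
apply: (mulfI detP'); rewrite [RHS]mulrC -!det_mulmx; congr (\det _).
rewrite mulmxBr mulmxBl -!map_mxM PA; congr (_ - _).
exact: scalar_mxC.
Qed.

Lemma mup_map (F F' : fieldType) (f : {rmorphism F -> F'}) (a : F)
    (p : {poly F}) :
  p != 0 -> mup (f a) (map_poly f p) = mup a p.
Proof.
move=> p0; have [m [q]] := multiplicity_XsubC p a; rewrite p0 /= => qa ->.
rewrite rmorphM rmorphXn /= map_polyXsubC !mupMr ?fmorph_root //.
by rewrite !mup_XsubCX !eqxx.
Qed.

(** After unitary diagonalization both numbers count the entries of [spectral_diag A] equal to
    [a]. *)
Lemma mup_char_poly_normal (C : numClosedFieldType) (n : nat) (A : 'M[C]_n)
    (a : C) :
  A \is normalmx -> mup a (char_poly A) = \rank (eigenspace A a).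
Proof.
move=> /orthomx_spectralP; set d := spectral_diag A.
set P := spectralmx A => AE.
have Pu : P \in unitmx := spectral_unit A.
have PA : P *m A = diag_mx d *m P by rewrite [in LHS]AE -mulmxA mulKVmx.
rewrite (char_poly_sim Pu PA) char_poly_trig ?diag_mx_is_trig //.
have -> : \prod_(i < n) ('X - (diag_mx d i i)%:P)
    = \prod_(y <- [seq d 0 i | i : 'I_n]) ('X - y%:P).
  by rewrite big_image /=; apply: eq_bigr => i _; rewrite mxE eqxx.
rewrite mu_prod_XsubC mxrank_ker.
have -> : \rank (A - a%:M)%R = \rank (diag_mx (d - const_mx a)).
  have PAa : P *m (A - a%:M) = diag_mx (d - const_mx a) *m P.
    by rewrite mulmxBr PA linearB mulmxBl /= diag_const_mx scalar_mxC.
  rewrite -(mxrankMfree (diag_mx _) (_ : row_free P)) ?row_free_unit // -PAa.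
  by rewrite eqmxMfull // row_full_unit.
rewrite mxrank_diag count_map; set q := preim _ _.
have -> : #|[pred i | (d - const_mx a) 0 i != 0]| = count (predC q) (enum 'I_n).
  rewrite enumT cardE /enum_mem size_filter; apply/eq_count => i /=.
  by rewrite !inE !mxE subr_eq0.
by rewrite -[X in (X - _)%N](size_enum_ord n) -(count_predC q) addnK.
Qed.

(** Both multiplicities survive the extension to [R[i]], where a real symmetric matrix is normal. *)
Lemma mup_char_poly_symmetric (R : realType) (n : nat) (A : 'M[R]_n) (a : R) :
  A^T = A -> mup a (char_poly A) = \rank (eigenspace A a).
Proof.
move=> AT; rewrite -(mup_map (real_complex R)) ?monic_neq0 ?char_poly_monic //.
rewrite map_char_poly mup_char_poly_normal; last first.
  apply: symmetric_normalmx; last first.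
    by apply/mxOverP=> i j; rewrite mxE; apply/complex_realP; exists (A i j).
  by apply/is_hermitianmxP; rewrite expr0 scale1r map_mx_id // map_trmx AT.
by rewrite -map_eigenspace mxrank_map.
Qed.

Lemma has_eigenvalue_mult_symmetricP (R : realType) (s : nat) (A : 'M[R]_s) :
  (2 <= s)%N -> A^T = A ->
  has_eigenvalue_mult_ge (s - 1) A <-> has_eigenspace_codim_le1 A.
Proof.
move=> s2 AT; split=> -[a].
  by move=> [_]; rewrite mup_char_poly_symmetric //; exists a.
move=> ra; exists a; rewrite mup_char_poly_symmetric //; split=> //.
(* As s - 1 >= 1, the eigenspace is nonzero. *)
rewrite /eigenvalue -mxrank_eq0; lia.
Qed.

(** * Zariski closure of the real matrices *)

Lemma symmetric_rank_le1_sqr (C : numClosedFieldType) (s : nat) (N : 'M[C]_s) :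
  N^T = N -> (\rank N <= 1)%N -> exists u : 'rV[C]_s, N = u^T *m u.
Proof.
move=> /matrixP NT /mxrank_le1P minors.
have sN x y : N x y = N y x by rewrite -[LHS]NT mxE.
have [->|/matrix0Pn[k [l Nkl]]] := eqVneq N 0.
  by exists 0; rewrite mulmx0.
(* The minors give N_kl^2 = N_kk N_ll. Then N_ij = N_ki N_kj / N_kk, and the denominator is split by
   a square root. *)
have Nkk : N k k != 0.
  apply: contraNneq Nkl => Nkk.
  by rewrite -sqrf_eq0 expr2 {2}sN minors Nkk mul0r.
exists (\row_j (N k j / sqrtC (N k k))); apply/matrixP=> i j.
rewrite !mxE big_ord1 !mxE mulrACA -invfM -expr2 sqrtCK.
by apply: (mulIf Nkk); rewrite mulfVK // minors (sN i k) mulrC.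
Qed.

Lemma zariski_closed_minor_equations (K : fieldType) (s : nat) :
  zariski_closed [set B : subvs_of (symv K s) | minor_equations (vsval B)].
Proof.
pose V : vectType K := subvs_of (symv K s).
(* The matrix entry (i, j) as a linear form in the coordinates for [vbasis]. *)
pose x i j : {mpoly K[\dim {:V}]} :=
  \sum_(k < \dim {:V}) vsval (vbasis {:V})`_k i j *: 'X_k.
have xE i j (v : V) : polyfun (x i j) v = vsval v i j.
  rewrite {2}(coord_vbasis (memvf v)) linear_sum summxE /polyfun /x.
  rewrite raddf_sum /=; apply: eq_bigr => k _.
  by rewrite mevalZ mevalXU mxE mulrC.
have [m2 m2E] :
    exists m2 : 'I_s -> 'I_s -> 'I_s -> 'I_s -> {mpoly K[\dim {:V}]},
    forall i j k l (v : V), polyfun (m2 i j k l) v = minor2 (vsval v) i j k l.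
  exists (fun i j k l => x i k * x j l - x i l * x j k) => i j k l v.
  by rewrite /minor2 -!xE /polyfun mevalB !mevalM.
have subE p q (v : V) : polyfun (p - q) v = polyfun p v - polyfun q v.
  exact: mevalB.
(* Taking the full vanishing ideal leaves only to check that each equation is one of its members. *)
exists [set p | forall v : V, minor_equations (vsval v) -> polyfun p v = 0].
apply/seteqP; split=> [v eqv p Ip|v eqv i j k l ijkl]; first exact: Ip.
split.
- by rewrite -m2E; apply: eqv => w /(_ i j k l ijkl)[e _ _]; rewrite m2E.
- apply/subr0_eq; rewrite -!m2E -subE; apply: eqv => w /(_ i j k l ijkl)[_ e _].
  by rewrite subE !m2E e subrr.
- apply/subr0_eq; rewrite -!m2E -!subE.
  apply: eqv => w /(_ i j k l ijkl)[_ _ e].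
  by rewrite !subE !m2E e subrr.
Qed.

Lemma zariski_closure_curve (K : fieldType) (V : vectType K) (S : set V)
    (n : nat) (c : 'I_n -> V) (x : nat -> K) (t : K) :
  injective x -> (forall m, S (\sum_(i < n) x m ^+ i *: c i)) ->
  zariski_closure S (\sum_(i < n) t ^+ i *: c i).
Proof.
move=> xI Sx Z [[I ->] SI] p Ip.
pose h k : {poly K} := \sum_i coord (vbasis {:V}) k (c i) *: 'X^i.
(* The pullback of [p] along the curve, a polynomial in one variable. *)
pose q : {poly K} := mmap polyC h p.
have hE k y : (h k).[y] = coord (vbasis {:V}) k (\sum_(i < n) y ^+ i *: c i).
  rewrite horner_sum linear_sum; apply: eq_bigr => i _.
  by rewrite hornerZ hornerXn linearZ mulrC.
have qE y : q.[y] = polyfun p (\sum_(i < n) y ^+ i *: c i).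
  rewrite /polyfun mevalE horner_sum; apply: eq_bigr => m _.
  rewrite hornerM hornerC horner_prod; congr (_ * _).
  by apply: eq_bigr => k _; rewrite horner_exp hE.
rewrite -qE (_ : q = 0) ?horner0 //.
(* [size q] distinct roots suffice, since the size exceeds the degree by one. *)
apply: (@roots_geq_poly_eq0 _ _ (map x (iota 0 (size q)))).
- apply/allP=> _ /mapP[m _ ->]; rewrite /root qE; apply/eqP.
  exact: SI (Sx m) _ Ip.
- by rewrite map_inj_uniq // iota_uniq.
- by rewrite size_map size_iota.
Qed.

Lemma minor_equations_sub_closure (R : realType) (s : nat) :
  (4 <= s)%N ->
  [set B : subvs_of (symv R[i] s) | minor_equations (vsval B)]
  `<=` zariski_closure (real_sym_mult_ge R s (s - 1)).
Proof.
move=> s4 B /= eqB.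
have s0 : (0 < s)%N by apply: leq_trans s4.
have s2 : (2 <= s)%N by apply: leq_trans s4.
have BT : (vsval B)^T = vsval B by exact/mem_symv/subvsP.
have [a rB] := (symmetric_minor_equationsP s4 BT).1 eqB.
have [u uE] : exists u : 'rV_s, vsval B - a%:M = u^T *m u.
  apply: symmetric_rank_le1_sqr rB.
  by rewrite linearB /= BT tr_scalar_mx.
pose toC := real_complex R.
pose u1 := map_mx (@complex.Re R) u; pose u2 := map_mx (@complex.Im R) u.
(* The coefficients of 1, t and t^2 of the curve. *)
pose c1 : 'M[R]_s := (complex.Re a)%:M + u1^T *m u1.
pose c2 : 'M[R]_s := (complex.Im a)%:M + (u1^T *m u2 + u2^T *m u1).
pose c3 : 'M[R]_s := u2^T *m u2.
pose c (i : 'I_3) :=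
  vsproj (symv R[i] s) (map_mx toC (tnth [tuple c1; c2; c3] i)).
have cE (t : R[i]) : \sum_(i < 3) t ^+ i *: c i = vsproj (symv R[i] s)
    (map_mx toC c1 + t *: map_mx toC c2 + t ^+ 2 *: map_mx toC c3).
  rewrite !big_ord_recl big_ord0 /c !(tnth_nth 0) /=.
  rewrite 2!(linearD (vsproj (symv R[i] s))).
  rewrite 2!(linearZ_LR (vsproj (symv R[i] s))).
  by rewrite scale1r addr0 expr1 addrA.
have BE : B = \sum_(i < 3) 'i ^+ i *: c i.
  rewrite cE -[LHS]vsvalK; congr (vsproj _ _).
  rewrite -[LHS](subrK a%:M) uE sqr_i.
  apply/matrixP=> i j; rewrite !mxE !big_ord1 !mxE /toC.
  move: (u 0 i) (u 0 j) a {uE rB c1 c2 c3 c cE} => [x1 y1] [x2 y2] [x3 y3].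
  by case: (i == j); rewrite ?mulr1n ?mulr0n; apply/eqP; rewrite eq_complex /=;
    apply/andP; split; apply/eqP; ring.
(* The real parameters are the natural numbers, distinct in characteristic 0. *)
rewrite BE; apply: (@zariski_closure_curve _ _ _ _ _ (fun m => m%:R)).
  by move=> x y /eqP; rewrite eqr_nat => /eqP.
move=> m; rewrite cE.
pose b := complex.Re a + m%:R * complex.Im a; pose v := u1 + m%:R *: u2.
exists (b%:M + v^T *m v).
have AT : (b%:M + v^T *m v)^T = b%:M + v^T *m v.
  by rewrite linearD /= tr_scalar_mx trmx_mul trmxK.
split=> //.
  apply/(has_eigenvalue_mult_symmetricP s2 AT)/(has_eigenspace_codim_le1P _ s0).
  exists b; rewrite addrC addKr.
  exact: leq_trans (mxrankM_maxr _ _) (rank_leq_row _).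
have mC : m%:R = toC m%:R by rewrite /toC rmorph_nat.
have -> : map_mx toC c1 + m%:R *: map_mx toC c2 + m%:R ^+ 2 *: map_mx toC c3
    = map_mx toC (b%:M + v^T *m v).
  rewrite mC -rmorphXn /= -!map_mxZ -!map_mxD; congr (map_mx toC _).
  apply/matrixP=> i j; rewrite !mxE !big_ord1 !mxE /b.
  by case: (i == j); rewrite ?mulr1n ?mulr0n; ring.
by rewrite vsprojK //; apply/mem_symv; rewrite map_trmx AT.
Qed.

Theorem corollary4p5 (R : realType) (s : nat) (hs : (4 <= s)%N) :
  (forall A : 'M[R[i]]_s, A^T = A ->
     (has_eigenspace_codim_le1 A <-> minor_equations A)) /\
  [set B : subvs_of (symv R[i] s) | minor_equations (vsval B)]
  = zariski_closure (real_sym_mult_ge R s (s - 1)).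
Proof.
have s0 : (0 < s)%N by apply: leq_trans hs.
have s2 : (2 <= s)%N by apply: leq_trans hs.
split=> [A AT|].
  by rewrite has_eigenspace_codim_le1P // symmetric_minor_equationsP.
apply/seteqP; split=> [B eqB|B]; last first.
  (* The closure lies in every closed set containing the real matrices, and the solution set is
     one. *)
  apply; split; first exact: zariski_closed_minor_equations.
  move=> {}B [A [AT /(has_eigenvalue_mult_symmetricP s2 AT)]].
  move=> /(has_eigenspace_codim_le1P _ s0)[a rA] BE /=.
  have BT : (vsval B)^T = vsval B by exact/mem_symv/subvsP.
  apply/(symmetric_minor_equationsP hs BT); exists a%:C.
  by rewrite BE -map_scalar_mx -map_mxB mxrank_map.
exact: minor_equations_sub_closure.
Qed.
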